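(* Let $I_1, I_2$ be nonzero proper ideals of the commutative rings $R_1, R_2$, respectively. Then the following statements are equivalent. (a) $I_1 \times I_2$ is an sdf-absorbing ideal of $R_1 \times R_2$. (b) $I_1, I_2$ are sdf-absorbing ideals of $R_1, R_2$, respectively, and $2 \in I_1$ or $2 \in I_2$.
   Context: All rings are commutative with identity $1 \neq 0$. A proper ideal $I$ of a commutative ring $R$ is a square-difference factor absorbing ideal (sdf-absorbing ideal) of $R$ if whenever $a, b \in R$ are both nonzero and $a^2 - b^2 \in I$, then $a + b \in I$ or $a - b \in I$. *)

(* Defs.v *)
From HB Require Import structures.
From mathcomp Require Import all_boot all_order all_algebra.
From mathcomp Require Import boolp classical_sets.

Set Implicit Arguments.
Unset Strict Implicit.
Unset Printing Implicit Defensive.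

Import GRing.Theory.
Local Open Scope ring_scope.

(* [idealr_closed] is 0 \in I, 1 \notin I and closure under a * u + v, so it
   already expresses that I is proper.  Ideals are classical sets rather than
   boolean predicates, so no decidability of membership is assumed. *)
Definition proper_idealr (R : comNzRingType) (I : set R) : Prop :=
  idealr_closed (mem I).

Definition sdf_absorbing (R : comNzRingType) (I : set R) : Prop :=
  proper_idealr I /\
  forall a b : R, a != 0 -> b != 0 -> a ^+ 2 - b ^+ 2 \in I ->
    a + b \in I \/ a - b \in I.

(* Main.v *)
Require Import Defs.
From mathcomp Require Import all_boot all_order all_algebra.
From mathcomp Require Import boolp classical_sets.

(** Zero components are what could separate the product from its factors: a
    nonzero pair may have a zero component, to which the sdf-absorbing property
    of the corresponding factor does not apply.  For a nonzero ideal this is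
    harmless: comparing [a] with a nonzero element of [I] shows that [a ^+ 2]
    in [I] forces [a] in [I], so the absorbing property holds for all elements
    ([sdf_absorbing_all]).

    The remaining obstruction is the choice of sign, which each component makes
    on its own.  When one of the ideals contains 2, sum and difference agree
    modulo that ideal ([addr_in_subr]), so that component follows the sign
    chosen by the other.  Conversely the pairs (1, 1) and (1, -1) have equal
    squares, sum (2, 0) and difference (0, 2), so some ideal must contain 2;
    each factor inherits the absorbing property through pairs whose other
    component is 0. *)

Import GRing.Theory.
Local Open Scope ring_scope.
Local Open Scope classical_set_scope.

Lemma proper_idealr_setX (R1 R2 : comNzRingType) (I1 : set R1) (I2 : set R2) :
  proper_idealr I1 -> proper_idealr I2 ->
  @proper_idealr (R1 * R2)%type (I1 `*` I2).
Proof.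
move=> [I10 I11 I1D] [I20 I21 I2D]; split => /=.
- by rewrite in_setX I10 I20.
- by rewrite in_setX (negbTE I11).
- move=> a u v; rewrite !in_setX => /andP[u1 u2] /andP[v1 v2].
  by rewrite I1D ?I2D.
Qed.

Lemma nonzero_idealr_exists (R : comNzRingType) (I : set R) :
  proper_idealr I -> I <> [set 0] -> exists2 i, i != 0 & i \in I.
Proof.
move=> [I0 _ _] In0; apply: contra_notP In0 => noi.
apply/seteqP; split => x /=; last by move->; apply/set_mem.
move=> Ix; apply: contra_notP noi => /eqP x0.
by exists x => //; apply/mem_set.
Qed.

(** A nonzero element [i] of [I] stands in for a zero argument, since it is
    congruent to 0 modulo [I]. *)
Lemma sdf_absorbing_all (R : comNzRingType) (I : set R) :
  I <> [set 0] -> sdf_absorbing I ->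
  forall a b : R, a ^+ 2 - b ^+ 2 \in I -> a + b \in I \/ a - b \in I.
Proof.
move=> In0 [I_proper sdfI].
have [i i0 Ii] := nonzero_idealr_exists _ _ I_proper In0.
have [I0 _ ID] := I_proper.
have IN x : x \in I -> - x \in I.
  by move=> Ix; rewrite -[- x]addr0 -mulN1r ID.
have radI a : a ^+ 2 \in I -> a \in I.
  have [-> //|a0 Ia2] := eqVneq a 0.
  have : a ^+ 2 - i ^+ 2 \in I by rewrite addrC expr2 -mulNr ID.
  move=> /sdfI -/(_ a0 i0) [Iai|Iai].
    by rewrite -(addKr i a) (addrC i) -mulN1r ID.
  by rewrite -(subrK i a) -[a - i]mul1r ID.
move=> a b; have [->|a0] := eqVneq a 0; have [->|b0] := eqVneq b 0.
- by rewrite addr0; left.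
- rewrite expr0n /= !add0r => /IN; rewrite opprK => /radI Ib.
  by left.
- by rewrite expr0n /= !subr0 => /radI Ia; right.
- exact: sdfI.
Qed.

Lemma addr_in_subr (R : comNzRingType) (I : set R) (a b : R) :
  proper_idealr I -> 2%:R \in I -> (a + b \in I) = (a - b \in I).
Proof.
move=> [_ _ ID] I2; apply/idP/idP => Iab.
- have -> : a - b = - b * 2%:R + (a + b).
    by rewrite mulr_natr mulr2n addrACA addNr addr0 addrC.
  exact: ID.
- have -> : a + b = b * 2%:R + (a - b).
    by rewrite mulr_natr mulr2n addrACA subrr addr0 addrC.
  exact: ID.
Qed.

Theorem theorem4p12 (R1 R2 : comNzRingType) (I1 : set R1) (I2 : set R2)
    (I1_proper : proper_idealr I1) (I2_proper : proper_idealr I2)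
    (I1_nonzero : I1 <> [set 0]) (I2_nonzero : I2 <> [set 0]) :
  @sdf_absorbing (R1 * R2)%type (I1 `*` I2) <->
  (sdf_absorbing I1 /\ sdf_absorbing I2) /\ (2%:R \in I1 \/ 2%:R \in I2).
Proof.
have [I10 _ _] := I1_proper; have [I20 _ _] := I2_proper.
split=> [[_ sdf12]|[[sdf1 sdf2] two]].
- split; first split.
  + split=> // a b a0 b0 Iab.
    have := sdf12 (a, 0) (b, 0); rewrite !in_setX /= -!expr2.
    rewrite !xpair_eqE !negb_and a0 b0 Iab /= expr0n /= subr0 addr0 I20 !andbT.
    exact.
  + split=> // a b a0 b0 Iab.
    have := sdf12 (0, a) (0, b); rewrite !in_setX /= -!expr2.
    rewrite !xpair_eqE !negb_and a0 b0 Iab /= expr0n /= subr0 addr0 I10 /=.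
    by rewrite !orbT; exact.
  + have := sdf12 (1, 1) (1, -1); rewrite !in_setX /= -!expr2.
    rewrite !xpair_eqE !negb_and !oner_eq0 sqrrN !subrr opprK I10 I20 /= andbT.
    exact.
- split; first exact: proper_idealr_setX.
  move=> a b _ _; rewrite !in_setX /= => /andP[].
  move=> /(sdf_absorbing_all _ _ I1_nonzero sdf1) ab1.
  move=> /(sdf_absorbing_all _ _ I2_nonzero sdf2) ab2.
  case: two => [two1|two2].
  + move: ab1; rewrite (addr_in_subr _ _ a.1 b.1 I1_proper two1).
    by move=> ab1; have -> : a.1 - b.1 \in I1 by case: ab1.
  + move: ab2; rewrite (addr_in_subr _ _ a.2 b.2 I2_proper two2).
    move=> ab2; have -> : a.2 - b.2 \in I2 by case: ab2.
    by rewrite !andbT.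
Qed.
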